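(* Let $n\ge 1$, let $\pi\in\mathcal{S}_n$ be a permutation, and let $(P,Q)$ be the pair of standard Young tableaux (insertion tableau $P$, recording tableau $Q$) associated with $\pi$ by the Robinson-Schensted-Knuth correspondence. Then $$\mathrm{sign}(\pi)=\mathrm{sign}(P)\cdot\mathrm{sign}(Q)\cdot(-1)^e,$$ where $e$ is the total length of all even-indexed rows of $P$ (that is, $e=\lambda_2+\lambda_4+\cdots$ if $P$ has shape $\lambda=(\lambda_1,\lambda_2,\ldots)$).
   Context: A standard Young tableau (tableau for short) of shape $\lambda\vdash n$ is a filling of the Young diagram of $\lambda$ (English convention: rows indexed $1,2,\ldots$ from top to bottom, row $i$ having $\lambda_i$ squares, left-justified) with the numbers $1,\ldots,n$, each used once, such that rows increase from left to right and columns increase from top to bottom. The Robinson-Schensted-Knuth correspondence is the bijection between $\mathcal{S}_n$ and pairs $(P,Q)$ of tableaux of the same shape $\lambda\vdash n$: $P$ (the insertion tableau) is obtained by successively row-inserting $\pi_1,\pi_2,\ldots,\pi_n$ (the one-line notation of $\pi$) into the empty tableau, and $Q$ (the recording tableau) has entry $i$ in the square added to the shape at the $i$th insertion. For a tableau $T$, a pair $(i,j)$ of entries is an inversion of $T$ if $j<i$ and $j$ is contained in a row strictly below the row of $i$. Let $\mathrm{inv}(T)$ be the number of inversions of $T$, and $\mathrm{sign}(T)=(-1)^{\mathrm{inv}(T)}$. For a permutation $\pi$, $\mathrm{sign}(\pi)$ is its usual sign. *)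

(* Defs.v *)
From mathcomp Require Import all_boot all_order all_fingroup all_algebra.

Set Implicit Arguments.
Unset Strict Implicit.
Unset Printing Implicit Defensive.

Import GRing.Theory.

(* A tableau is the sequence of its rows, listed from top to bottom, each row
   read from left to right. Rows are indexed from 0, entries are 1, ..., n. *)
Definition tableau := seq (seq nat).

(* Row insertion of x into r: x replaces the leftmost entry y > x, which is
   returned as Some y, or is appended to r if there is no such entry. *)
Fixpoint row_insert (x : nat) (r : seq nat) : seq nat * option nat :=
  match r with
  | [::] => ([:: x], None)
  | y :: r' =>
      if x < y then (x :: r', Some y)
      else let: (r'', bumped) := row_insert x r' in (y :: r'', bumped)
  end.

(* The second component is the index of the row in which the new square of the
   shape has been created (always at the right end of that row). *)
Fixpoint tab_insert (x : nat) (T : tableau) : tableau * nat :=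
  match T with
  | [::] => ([:: [:: x]], 0)
  | r :: T' =>
      match row_insert x r with
      | (r', None) => (r' :: T', 0)
      | (r', Some y) =>
          let: (T'', k) := tab_insert y T' in (r' :: T'', k.+1)
      end
  end.

Definition add_to_row (k i : nat) (T : tableau) : tableau :=
  set_nth [::] T k (rcons (nth [::] T k) i).

(* ix = (i, x): x is the letter inserted at step i. *)
Definition rsk_step (PQ : tableau * tableau) (ix : nat * nat) :
    tableau * tableau :=
  let: (P', k) := tab_insert ix.2 PQ.1 in (P', add_to_row k ix.1 PQ.2).

Definition rsk_word (w : seq nat) : tableau * tableau :=
  foldl rsk_step ([::], [::]) (zip (iota 1 (size w)) w).

(* 'S_n permutes {0, ..., n-1}, hence the shift by one. *)
Definition one_line (n : nat) (s : 'S_n) : seq nat :=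
  [seq (val (s i)).+1 | i <- enum 'I_n].

Definition rsk (n : nat) (s : 'S_n) : tableau * tableau :=
  rsk_word (one_line s).

Definition row_of (T : tableau) (x : nat) : nat :=
  find (fun r : seq nat => x \in r) T.

Definition is_inversion (T : tableau) (p : nat * nat) : bool :=
  (p.2 < p.1) && (row_of T p.1 < row_of T p.2).

Definition tab_inv (T : tableau) : nat :=
  count (is_inversion T) [seq (i, j) | i <- flatten T, j <- flatten T].

Definition tab_sign (T : tableau) : int := ((-1) ^+ tab_inv T)%R.

Definition perm_sign (n : nat) (s : 'S_n) : int := ((-1) ^+ odd_perm s)%R.

(* The rows with an even index counted from 1 are those with an odd index
   counted from 0. *)
Definition even_rows_length (T : tableau) : nat :=
  \sum_(k < size T | odd k) size (nth [::] T k).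

(* Main.v *)
(* Write [x -> P] for the insertion of x into P, let k be the (0-based) row of
   the new square and [lambda_r] the row lengths. Appending x to the word
   creates #{y in P, y > x} inversions; the entry recording that step is the
   largest of Q, so it creates [\sum_(r > k) lambda_r] inversions of Q; and the
   even rows gain a square iff k is odd. So the theorem reduces to
     inv(x -> P) - inv(P) = #{y in P, y > x} + \sum_(r > k) lambda_r + k  (mod 2),
   which follows by induction on the rows of P: when x bumps y out of a row r,
   the letters of r above x are y and the letters of r above y, and every letter
   of the rows below r is either smaller or larger than x, and likewise for y. *)
Require Import Defs.
From mathcomp Require Import all_boot all_order all_fingroup all_algebra.
From mathcomp Require Import zify.

Set Implicit Arguments.
Unset Strict Implicit.
Unset Printing Implicit Defensive.

(** * Inversions of words and the sign of a permutation *)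

Lemma count_ltn_gtn (x : nat) (s : seq nat) :
  x \notin s -> count (fun y => y < x) s + count (fun y => x < y) s = size s.
Proof.
move=> xs; rewrite -(count_predC (fun y => y < x)); congr (_ + _).
apply: eq_in_count => y ys /=.
by rewrite -leqNgt ltn_neqAle (memPnC xs).
Qed.

Fixpoint word_inv (w : seq nat) : nat :=
  if w is a :: w' then count (fun b => b < a) w' + word_inv w' else 0.

Lemma word_inv_rcons (w : seq nat) (x : nat) :
  word_inv (rcons w x) = word_inv w + count (fun y => x < y) w.
Proof. by elim: w => //= a w ->; rewrite -cats1 count_cat /=; lia. Qed.

Lemma word_inv_map (f : nat -> nat) (w : seq nat) :
  (forall a b, (f a < f b) = (a < b)) -> word_inv (map f w) = word_inv w.
Proof.
move=> fE; elim: w => //= a w ->; rewrite count_map; congr (_ + _).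
by apply: eq_count => b /=.
Qed.

Lemma count_ltn_iota (m n : nat) : count (fun k => k < m) (iota 0 n) = minn m n.
Proof.
elim: n => [|n IH]; first by rewrite minn0.
by rewrite -addn1 iotaD count_cat IH /=; lia.
Qed.

(** Deleting the first letter of the one-line notation and closing the gap in the values gives [t];
    the sign can then be computed by induction on [n]. *)
Lemma lift_permP (n : nat) (s : 'S_n.+1) :
  exists t : 'S_n, s = lift_perm ord0 (s ord0) t.
Proof.
(* The default [k] is never taken: [s] is injective, so [s (lift ord0 k)] differs from [s ord0]. *)
pose f k := odflt k (unlift (s ord0) (s (lift ord0 k))).
have fE k : lift (s ord0) (f k) = s (lift ord0 k).
  rewrite /f; case: unliftP => [j -> //|/perm_inj/eqP].
  by rewrite eq_sym (negPf (neq_lift _ _)).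
have f_inj : injective f.
  move=> i j fij; apply: (@lift_inj _ ord0); apply: (@perm_inj _ s).
  by rewrite -!fE fij.
exists (perm f_inj); apply/permP => i; case: (unliftP ord0 i) => [j|] ->.
  by rewrite lift_perm_lift permE fE.
by rewrite lift_perm_id.
Qed.

(** The first letter [h] exceeds exactly [h] of the other letters, and [odd_lift_perm] contributes
    the parity of [h]. The other letters are those of [t] moved by [bump h], which preserves
    order. *)
Lemma odd_perm_word_inv (n : nat) (s : 'S_n) :
  odd_perm s = odd (word_inv [seq val (s i) | i <- enum 'I_n]).
Proof.
elim: n s => [|n IH] s.
  have -> : enum 'I_0 = [::] by apply: size0nil; rewrite size_enum_ord.
  have -> : s = 1%g by apply/permP => -[].
  by rewrite odd_perm1.
have [t ->] := lift_permP s; set h := s ord0.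
rewrite odd_lift_perm IH enum_ordSl /= lift_perm_id -map_comp.
pose w := [seq val (t i) | i <- enum 'I_n].
rewrite [in RHS](eq_map (g := bump h \o (fun i => val (t i)))); last first.
  by move=> i /=; rewrite lift_perm_lift.
rewrite [in RHS]map_comp -/w oddD word_inv_map; last by move=> a b; rewrite /bump; lia.
congr (odd _ (+) _).
have pw : perm_eq w (iota 0 n).
  rewrite -val_enum_ord /w (map_comp val t); apply: perm_map.
  apply: uniq_perm; rewrite ?enum_uniq ?(map_inj_uniq (@perm_inj _ t)) ?enum_uniq //.
  move=> i; rewrite mem_enum -(permKV t i) mem_map ?mem_enum //.
  exact: perm_inj.
rewrite count_map (eq_count (a2 := fun k => k < h)); last first.
  by move=> k; rewrite /= /bump; lia.
by rewrite (seq.permP pw) count_ltn_iota (minn_idPl _) // -ltnS.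
Qed.

(** * Inversions of a tableau, counted row by row *)

Definition cross_inv (r w : seq nat) : nat :=
  \sum_(a <- r) count (fun b => b < a) w.

Fixpoint row_inv (T : tableau) : nat :=
  if T is r :: T' then cross_inv r (flatten T') + row_inv T' else 0.

Lemma perm_cross_inv (r r' w w' : seq nat) :
  perm_eq r r' -> perm_eq w w' -> cross_inv r w = cross_inv r' w'.
Proof.
move=> pr pw; rewrite /cross_inv (perm_big _ pr).
by apply: eq_bigr => a _; rewrite (seq.permP pw).
Qed.

Lemma cross_inv_consl (x : nat) (r w : seq nat) :
  cross_inv (x :: r) w = count (fun b => b < x) w + cross_inv r w.
Proof. by rewrite /cross_inv big_cons. Qed.

Lemma cross_inv_consr (x : nat) (r w : seq nat) :
  cross_inv r (x :: w) = count (fun a => x < a) r + cross_inv r w.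
Proof.
rewrite /cross_inv; elim: r => [|a r IH] /=; first by rewrite !big_nil.
by rewrite !big_cons IH /=; lia.
Qed.

Lemma tab_invE (T : tableau) :
  tab_inv T = \sum_(i <- flatten T) \sum_(j <- flatten T) is_inversion T (i, j).
Proof. by rewrite /tab_inv -sum1_count big_mkcond big_allpairs. Qed.

(** Since [row_of] finds the first row containing an entry, distinct entries ensure that those of
    [T] lie one row lower in [r :: T], while those of [r] lie in row 0. *)
Lemma tab_inv_row_inv (T : tableau) : uniq (flatten T) -> tab_inv T = row_inv T.
Proof.
elim: T => [|r T IH] /=; first by rewrite tab_invE /= big_nil.
rewrite cat_uniq => /and3P[_ /hasPn rT uT]; rewrite -IH // !tab_invE /= big_cat /=.
have rowT j : j \in flatten T -> row_of (r :: T) j = (row_of T j).+1.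
  by move=> /rT/negPf; rewrite /row_of /= => ->.
have rowr j : j \in r -> row_of (r :: T) j = 0 by rewrite /row_of /= => ->.
have invE i j : is_inversion (r :: T) (i, j) =
    (j < i) && (row_of (r :: T) i < row_of (r :: T) j) by [].
congr (_ + _); apply: eq_big_seq => i iT; rewrite big_cat /=.
  rewrite big1_seq ?add0n.
    rewrite -sum1_count [RHS]big_mkcond; apply: eq_big_seq => j jT.
    by rewrite invE rowr // rowT // andbT; case: (_ < _).
  by move=> j /andP[_ jr]; rewrite invE !rowr // andbF.
rewrite big1_seq ?add0n; last first.
  by move=> j /andP[_ jr]; rewrite invE (rowr j) // andbF.
by apply: eq_big_seq => j jT; rewrite invE !rowT.
Qed.

(** * Effect of insertion on entries, shape and inversions *)

Lemma row_insert_None (x : nat) (r r' : seq nat) :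
  row_insert x r = (r', None) ->
  r' = rcons r x /\ count (fun a => x < a) r = 0.
Proof.
elim: r r' => [|y r IH] r' /=; first by case=> <-.
case: ltnP => // yx; case E: (row_insert x r) => [r1 b] [<- eb].
by rewrite eb in E; have [-> ->] := IH _ E.
Qed.

Lemma row_insert_Some (x y : nat) (r r' : seq nat) :
  pairwise ltn r -> x \notin r -> row_insert x r = (r', Some y) ->
  [/\ perm_eq (y :: r') (x :: r), pairwise ltn r'
    & count (fun a => x < a) r = (count (fun a => y < a) r).+1].
Proof.
elim: r r' => [|z r IH] r' //= /andP[zr pr].
rewrite inE negb_or => /andP[xz xr]; case: ltnP => [ltxz|lezx].
  case=> <- <-; split=> /=.
  - by rewrite (perm_catCA [:: z] [:: x] r).
  - rewrite pr andbT; apply: sub_all zr => a; exact: ltn_trans.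
  - rewrite ltnn; congr (_.+1); apply: eq_in_count => a /(allP zr) /= za.
    by rewrite za (ltn_trans ltxz).
case E: (row_insert x r) => [r1 b] [<- eb]; rewrite {}eb in E.
have [p p1 c] := IH _ pr xr E.
have ltzx : z < x by rewrite ltn_neqAle eq_sym xz.
have mem1 a : (a \in y :: r1) = (a \in x :: r) by rewrite (perm_mem p).
(* This covers both [y] and the new tail: the row stays increasing, and [z] is counted neither above
   [x] nor above [y]. *)
have zall a : a \in y :: r1 -> z < a.
  by rewrite mem1 inE => /predU1P[-> //|/(allP zr)].
split=> /=.
- rewrite (perm_catCA [:: y] [:: z] r1) perm_sym.
  by rewrite (perm_catCA [:: x] [:: z] r) /= perm_cons perm_sym.
- by apply/andP; split=> //; apply/allP => a ar; apply: zall; rewrite inE ar orbT.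
- by rewrite c (ltnNge y) (ltnW (zall _ (mem_head _ _))).
Qed.

(** Lets the recursion continue: the bumped letter is new to the rows below. *)
Lemma uniq_bumped (x y : nat) (r r' w : seq nat) :
  perm_eq (y :: r') (x :: r) -> uniq (x :: r ++ w) -> uniq (y :: w).
Proof.
rewrite -(perm_cat2r w) => /perm_uniq /= <-.
by rewrite mem_cat negb_or cat_uniq => /andP[/andP[_ ->] /and3P[]].
Qed.

Lemma size_row_insert_Some (x y : nat) (r r' : seq nat) :
  row_insert x r = (r', Some y) -> size r' = size r.
Proof.
elim: r r' => [|z r IH] r' //=; case: ltnP => [_ [<- _] //|_].
by case E: (row_insert x r) => [r1 b] [<- eb] /=; rewrite eb in E; rewrite (IH _ E).
Qed.

Lemma shape_tab_insert (x k : nat) (T T' : tableau) :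
  tab_insert x T = (T', k) -> shape T' = incr_nth (shape T) k /\ k <= size T.
Proof.
elim: T x T' k => [|r T IH] x T' k /=; first by case=> <- <-.
case E: (row_insert x r) => [r' [y|]].
  case E1: (tab_insert y T) => [T1 k1] [<- <-] /=.
  by have [-> ?] := IH _ _ _ E1; rewrite (size_row_insert_Some E).
by case=> <- <-; have [-> _] := row_insert_None E; rewrite /= size_rcons.
Qed.

Lemma tab_insert_perm (x k : nat) (T T' : tableau) :
  all (pairwise ltn) T -> uniq (x :: flatten T) -> tab_insert x T = (T', k) ->
  perm_eq (flatten T') (x :: flatten T) /\ all (pairwise ltn) T'.
Proof.
elim: T x T' k => [|r T IH] x T' k /=; first by move=> _ _ [<- _].
move=> /andP[sr sT] /[dup] u; rewrite mem_cat negb_or => /andP[/andP[xr xT] _].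
case E: (row_insert x r) => [r' [y|]].
  have [p sr' _] := row_insert_Some sr xr E.
  case E1: (tab_insert y T) => [T1 k1] [<- _] /=.
  have [p1 ->] := IH _ _ _ sT (uniq_bumped p u) E1; split; last by rewrite sr'.
  have pT : perm_eq (y :: r' ++ flatten T) (x :: r ++ flatten T).
    by rewrite -!cat_cons perm_cat2r.
  apply: perm_trans pT; rewrite -(perm_cat2l r') in p1.
  by apply: (perm_trans p1); rewrite (perm_catCA r' [:: y]).
case=> <- _; have [-> c] := row_insert_None E; split.
  by rewrite /= -cats1 -catA (perm_catCA r [:: x]).
rewrite /= sT andbT pairwise_rcons sr andbT.
apply/allP => a ar; rewrite /= ltn_neqAle (memPn xr) // leqNgt.
by move/eqP: c; rewrite -leqn0 leqNgt -has_count => /hasPn/(_ a ar).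
Qed.

Lemma odd_row_inv_insert (x k : nat) (T T' : tableau) :
  all (pairwise ltn) T -> uniq (x :: flatten T) -> tab_insert x T = (T', k) ->
  odd (row_inv T') =
    odd (row_inv T + count (fun y => x < y) (flatten T)
         + sumn (drop k.+1 (shape T)) + k).
Proof.
elim: T x T' k => [|r T IH] x T' k /=.
  by move=> _ _ [<- <-] /=; rewrite /cross_inv big_seq1.
move=> /andP[sr sT] /[dup] u; rewrite mem_cat negb_or => /andP[/andP[xr xT] _].
have cx := count_ltn_gtn xT.
case E: (row_insert x r) => [r' [y|]]; last first.
  case=> <- <- /=; have [-> c] := row_insert_None E.
  (* The entries below row 0 split into those smaller and those larger than [x]. The larger ones
     occur twice in the claim and cancel mod 2; the smaller ones are the new inversions of [x]. *)
  rewrite drop0 -size_flatten count_cat c.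
  rewrite (perm_cross_inv (r' := x :: r) (w' := flatten T)) ?perm_rcons //.
  by rewrite cross_inv_consl; lia.
have [p sr' c] := row_insert_Some sr xr E.
case E1: (tab_insert y T) => [T1 k1] [<- <-] /=.
have uy := uniq_bumped p u.
have [p1 _] := tab_insert_perm sT uy E1.
have {IH} := IH _ _ _ sT uy E1.
have cy := count_ltn_gtn (proj1 (andP uy)).
(* Replacing [y] by [x] in the row changes its inversions with [T] by the number of entries of [T]
   below [x] minus the number below [y]; [cx] and [cy] turn these into counts of larger entries. *)
have := perm_cross_inv p (perm_refl (flatten T)); rewrite !cross_inv_consl.
rewrite (perm_cross_inv (perm_refl r') p1) cross_inv_consr count_cat.
have := seq.permP p (fun a => y < a); rewrite /= ltnn.
(* Otherwise every entry above [x] would be above [y], against the count [c]. *)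
have ltxy : x < y.
  rewrite ltnNge; apply/negP => leyx.
  suff : count (fun a => x < a) r <= count (fun a => y < a) r by rewrite c ltnn.
  by apply: sub_count => a; apply: leq_ltn_trans.
rewrite ltnNge (ltnW ltxy) /= => e1 e2 o1; rewrite oddD o1 -oddD.
move: c cx cy e1 e2; clear; lia.
Qed.

(** * The recording tableau and the even rows *)

Lemma shape_add_to_row (k i : nat) (T : tableau) :
  k <= size T -> shape (add_to_row k i T) = incr_nth (shape T) k.
Proof.
(* For [k <= size T], [set_nth] extends a row or starts the next one, without padding by empty
   rows. *)
rewrite /add_to_row; elim: T k => [|r T IH] [|k] //=; first by rewrite size_rcons.
by rewrite ltnS => /IH <-.
Qed.

Lemma perm_add_to_row (k i : nat) (T : tableau) :
  k <= size T -> perm_eq (flatten (add_to_row k i T)) (i :: flatten T).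
Proof.
rewrite /add_to_row; elim: T k => [|r T IH] [|k] //=.
  by rewrite /= -cats1 -catA (perm_catCA r [:: i]).
rewrite ltnS => /IH p; rewrite -(perm_cat2l r) in p.
by apply: (perm_trans p); rewrite (perm_catCA r [:: i]).
Qed.

Lemma row_inv_add_to_row (k i : nat) (T : tableau) :
  k <= size T -> all (fun j => j < i) (flatten T) ->
  row_inv (add_to_row k i T) = row_inv T + sumn (drop k.+1 (shape T)).
Proof.
elim: T k => [|r T IH] [|k] //=.
- by rewrite /add_to_row /= /cross_inv big_seq1.
- rewrite all_cat drop0 -size_flatten => _ /andP[_]; rewrite all_count => /eqP c.
  rewrite (perm_cross_inv (r' := i :: r) (w' := flatten T)) ?perm_rcons //.
  by rewrite cross_inv_consl c; lia.
rewrite ltnS all_cat => kT /andP[ri Ti]; have {IH} := IH _ kT Ti.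
rewrite -/(add_to_row k i T) => ->.
rewrite (perm_cross_inv (perm_refl r) (perm_add_to_row i kT)) cross_inv_consr.
rewrite (_ : count _ r = 0); first lia.
apply/eqP; rewrite -leqn0 leqNgt -has_count; apply/hasPn => a /(allP ri) ai.
by rewrite -leqNgt ltnW.
Qed.

(** Depends on the shape alone, so that insertion acts on it through [incr_nth]. *)
Definition odd_index_sum (s : seq nat) : nat := \sum_(k < size s | odd k) nth 0 s k.

Lemma odd_index_sum_incr_nth (s : seq nat) (k : nat) :
  odd_index_sum (incr_nth s k) = odd_index_sum s + odd k.
Proof.
(* The range of summation may grow, so both sums are taken up to [N], where [nth] gives 0 past the
   end of [s]. *)
rewrite /odd_index_sum; set N := size (incr_nth s k).
have kN : k < N by rewrite /N size_incr_nth; case: (ltnP k (size s)).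
have sN : size s <= N by rewrite /N size_incr_nth; case: (ltnP k (size s)) => // /leqW.
rewrite (eq_bigr (fun i : 'I_N => nth 0 s i + (k == i))); last first.
  by move=> i _; rewrite nth_incr_nth addnC.
rewrite big_split /=; congr (_ + _).
  rewrite (big_ord_widen_cond _ odd (nth 0 s) sN) [LHS]big_mkcond [RHS]big_mkcond.
  apply: eq_bigr => i _; case: odd => //=.
  by case: ltnP => // ?; rewrite nth_default.
rewrite big_mkcond (bigD1 (Ordinal kN)) //= eqxx big1 ?addn0; first by case: odd.
by move=> i; rewrite -val_eqE /= eq_sym => /negPf->; case: odd.
Qed.

Lemma even_rows_lengthE (T : tableau) :
  even_rows_length T = odd_index_sum (shape T).
Proof.
rewrite /even_rows_length /odd_index_sum size_map.
by apply: eq_bigr => k _; rewrite (nth_map [::]).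
Qed.

(** * Induction on the word *)

Lemma rsk_word_rcons (w : seq nat) (x : nat) :
  rsk_word (rcons w x) = rsk_step (rsk_word w) ((size w).+1, x).
Proof.
rewrite /rsk_word size_rcons -(addn1 (size w)) iotaD /= add1n addn1 cats1.
by rewrite zip_rcons ?size_iota // foldl_rcons.
Qed.

(** The induction appends letters on the right, as RSK reads them. The content of [Q] makes each new
    recording entry the largest; the common shape makes the lengths of the rows below the new
    square, contributed by both [P] and [Q], cancel mod 2. *)
Lemma rsk_word_inv (w : seq nat) (P Q : tableau) :
  uniq w -> rsk_word w = (P, Q) ->
  [/\ perm_eq (flatten P) w, perm_eq (flatten Q) (iota 1 (size w)),
      all (pairwise ltn) P, shape P = shape Q
    & odd (word_inv w) = odd (row_inv P + row_inv Q + even_rows_length P)].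
Proof.
elim/last_ind: w P Q => [|w x IH] P' Q'.
  by move=> _ [<- <-]; split=> //=; rewrite /even_rows_length big_ord0.
rewrite rsk_word_rcons rcons_uniq => /andP[xw uw].
case E: (rsk_word w) => [P Q]; have [pP pQ sP sh IHo] := IH _ _ uw E.
rewrite /rsk_step /=; case E1: (tab_insert x P) => [P1 k] [<- <-].
have uP : uniq (x :: flatten P) by rewrite /= (perm_mem pP) xw (perm_uniq pP).
have [pP1 sP1] := tab_insert_perm sP uP E1.
have [shP1 kP] := shape_tab_insert E1.
have kQ : k <= size Q by rewrite -(size_map size Q) -/(shape Q) -sh size_map.
have ltQ : all (fun j => j < (size w).+1) (flatten Q).
  by rewrite (perm_all _ pQ); apply/allP => j; rewrite mem_iota add1n => /andP[].
split=> //.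
- apply: (perm_trans pP1); rewrite perm_sym perm_rcons perm_cons perm_sym.
  exact: pP.
- apply: (perm_trans (perm_add_to_row _ kQ)).
  rewrite size_rcons -(addn1 (size w)) iotaD /= add1n addn1 cats1.
  by rewrite perm_sym perm_rcons perm_cons perm_sym.
- by rewrite shP1 shape_add_to_row // sh.
rewrite word_inv_rcons row_inv_add_to_row // -sh.
have := odd_row_inv_insert sP uP E1; rewrite (seq.permP pP) => o1.
rewrite !even_rows_lengthE shP1 odd_index_sum_incr_nth in IHo *.
move: IHo o1; rewrite !oddD oddb => -> ->.
by case: (odd (row_inv P)); case: (odd (row_inv Q));
   case: (odd (count _ _)); case: (odd (sumn _)); case: (odd k); case: (odd _).
Qed.

Theorem theorem4p3 (n : nat) (hn : 0 < n) (s : 'S_n) (P Q : tableau)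
    (hPQ : rsk s = (P, Q)) :
  perm_sign s = (tab_sign P * tab_sign Q * (-1) ^+ even_rows_length P)%R.
Proof.
have wE : one_line s = map S [seq val (s i) | i <- enum 'I_n] by rewrite -map_comp.
have uw : uniq (one_line s).
  by rewrite map_inj_uniq ?enum_uniq // => i j [/val_inj/perm_inj].
have [pP pQ _ _ o] := rsk_word_inv uw hPQ.
rewrite /perm_sign /tab_sign.
rewrite !tab_inv_row_inv ?(perm_uniq pP) ?(perm_uniq pQ) ?iota_uniq //.
(* The shift by one in [one_line] preserves order, hence the number of inversions. *)
rewrite odd_perm_word_inv -(word_inv_map (f := S)) // -wE o.
by rewrite GRing.signr_odd !GRing.exprD.
Qed.
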